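(* There is an infinite sequence of connected asymmetric graphs $G$, with orders tending to infinity, such that $$\operatorname{psd}(G)\ge |V(G)|-O\!\left(\frac{(\log|V(G)|)^2}{\log\log|V(G)|}\right),$$ where the implied constant is absolute. Moreover, every intermediate graph in the corresponding active chain is connected and asymmetric. That is, there are an absolute constant $C$ and, for each graph $G$ of the sequence, an active pseudosimilarity chain $v_1,\ldots,v_k$ in $G$ of length $k\ge |V(G)|-C\,(\log|V(G)|)^2/\log\log|V(G)|$ such that each of the graphs $G-\{v_1,\ldots,v_j\}$, $0\le j\le k$, is connected and asymmetric.
   Context: All graphs are finite and simple. A graph is asymmetric if its only automorphism is the identity. For a graph $G$ and vertices $u,v\in V(G)$: $u,v$ are similar if some automorphism of $G$ maps $u$ to $v$; they are removal-similar if $G-u\cong G-v$; they are pseudosimilar if they are removal-similar but not similar. A pseudosimilar mate of $v$ in $G$ is a vertex $u$ of $G$ such that $u,v$ are pseudosimilar in $G$. An active pseudosimilarity chain of length $k$ in $G$ is a sequence of distinct vertices $v_1,\ldots,v_k$ of $G$ such that, for each $j=0,\ldots,k-1$, writing $G_j=G-\{v_1,\ldots,v_j\}$ (so $G_0=G$), the vertex $v_{j+1}$ has a pseudosimilar mate in $G_j$. The pseudosimilarity depth $\operatorname{psd}(G)$ is the maximum $k$ such that $G$ has an active pseudosimilarity chain of length $k$ (the empty chain has length $0$). *)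

(* Defs.v *)
From mathcomp Require Import all_boot all_order all_algebra.
From mathcomp Require Import all_classical all_reals all_analysis.
Set Implicit Arguments.
Unset Strict Implicit.
Unset Printing Implicit Defensive.

Record sgraph := SGraph {
  vertex :> finType;
  adj : rel vertex;
  adj_sym : symmetric adj;
  adj_irrefl : irreflexive adj }.
Arguments adj {s} x y.

Definition connected_graph (G : sgraph) : Prop :=
  0 < #|G| /\ forall x y : G, connect adj x y.

Definition isomorphism (G H : sgraph) (f : G -> H) : Prop :=
  bijective f /\ forall x y : G, adj (f x) (f y) = adj x y.

Definition isomorphic (G H : sgraph) : Prop :=
  exists f : G -> H, isomorphism f.

Definition asymmetric_graph (G : sgraph) : Prop :=
  forall f : G -> G, isomorphism f -> f =1 id.

Section Deletion.
Variables (G : sgraph) (S : {set G}).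

Definition del_adj : rel {x : G | x \notin S} := fun x y => adj (val x) (val y).

Lemma del_adj_sym : symmetric del_adj.
Proof. by move=> x y; apply: adj_sym. Qed.

Lemma del_adj_irrefl : irreflexive del_adj.
Proof. by move=> x; apply: adj_irrefl. Qed.

Definition del_vertices : sgraph := SGraph del_adj_sym del_adj_irrefl.

End Deletion.

Definition similar (G : sgraph) (u v : G) : Prop :=
  exists f : G -> G, isomorphism f /\ f u = v.

Definition removal_similar (G : sgraph) (u v : G) : Prop :=
  isomorphic (del_vertices [set u]) (del_vertices [set v]).

Definition pseudosimilar (G : sgraph) (u v : G) : Prop :=
  removal_similar u v /\ ~ similar u v.

Definition has_pseudosimilar_mate (G : sgraph) (v : G) : Prop :=
  exists u : G, pseudosimilar u v.

(* The graph G_j = G - {v_1, ..., v_j}, where v_1, ..., v_j are the first [j] entries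
   of [s]. *)
Definition chain_graph (G : sgraph) (s : seq G) (j : nat) : sgraph :=
  del_vertices [set x in take j s].

(* [s] is 0-indexed, so its entry of index [j] is the vertex v_{j+1}; it is
   represented by [x] in the subtype of the vertices of G_j. *)
Definition active_chain (G : sgraph) (s : seq G) : Prop :=
  uniq s /\
  forall j, j < size s ->
    exists x : chain_graph s j,
      onth s j = Some (val x) /\ has_pseudosimilar_mate x.

(* The entries of a chain are distinct, so its length is at most #|G|. *)
Definition psd (G : sgraph) : nat :=
  \max_(k < #|G|.+1 | `[< exists s : seq G, active_chain s /\ size s = k >]) k.

(* Main.v *)
Require Import Defs.
From mathcomp Require Import all_boot all_order all_algebra.
From mathcomp Require Import all_classical all_reals all_analysis.
From mathcomp Require Import zify ring lra.
Set Implicit Arguments.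
Unset Strict Implicit.
Unset Printing Implicit Defensive.

(** A small core with a rotation of huge order carries outer vertices, which the rotation
    would permute cyclically if all were present. Only an interval of them is: its two ends
    are exchangeable for deletion, and the gap destroys all symmetry.

    Fix distinct primes [p 0, ..., p (r-1)], all at most [X], with product [N]. The core
    of the graph is the disjoint union, over [j < r], of an oriented cycle of length
    [p j]; orientation is encoded by replacing each point by a triangle (hub, tip, link)
    and joining each link to the hub of the next triangle. The core thus admits the
    rotation [y |-> y + 1] on all its cycles simultaneously, of order [N]. For [k < N]
    add outer vertices numbered [0, ..., k-1], the [i]-th one adjacent to the hub at
    position [i mod p j] of every cycle [j]. Deleting the first or the last outer vertex
    leaves isomorphic graphs, the isomorphism being the rotation, which adds one to every
    number ([coded_removal_similar]).

    The graph is asymmetric as soon as [X <= k < N] ([coded_asymmetric]). Indeed an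
    automorphism [f] preserves the four sorts of vertices: outer vertices are those in no
    triangle, hubs are the others adjacent to an outer vertex, and links the remaining
    ones adjacent to two hubs. Hence [f] commutes with the successor map on hubs; looking
    at its orbits, whose lengths are distinct primes, [f] preserves each cycle. So the
    numbers of [f u'] and [f u] differ by one modulo every [p j], hence modulo [N], when
    those of [u'] and [u] differ by one. As all numbers are smaller than [k < N], there
    is no wrapping around: [f] translates the interval [0, ..., k-1] into itself, hence
    fixes the outer vertices, and then everything else.

    Removing the outer vertices one at a time in decreasing order, from [N - 1] of them
    down to [X], therefore gives an active chain missing at most [4 r X] vertices of the
    graph ([coded_chain], [card_base_graph]).

    It remains to choose the primes ([many_primes]). The prime power factors of [n]
    choose [m] are at most [n], so that summing over [m] bounds [2 ^ n] by
    [(n + 1) n ^ pi(n)], where [pi(n)] counts the primes up to [n]. With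
    [s = 2 ^ t], [X = 2 ^ s] and [r = X / (4 s)] this yields [r] primes between [r] and
    [X]. Then [log N] is of order [r log X], that is of order [X], while [r X] is of order
    [X ^ 2 / log X], that is of order [(log N) ^ 2 / log log N] ([log_bound]). *)

(** * Many primes below a power of two *)

Lemma logn_fact_wide p n M : prime p -> n <= M ->
  logn p n`! = \sum_(1 <= k < M.+1) n %/ p ^ k.
Proof.
move=> pp nM; rewrite logn_fact // [RHS](@big_cat_nat _ _ _ n.+1) //=.
rewrite [X in _ = _ + X]big_nat_cond [X in _ = _ + X]big1 ?addn0 // => k /andP[/andP[nk _] _].
by rewrite divn_small // (ltn_trans nk) // ltn_expl // prime_gt1.
Qed.

(** Legendre's formula: each power of [p] up to [n] contributes at most one to the
    valuation. *)
Lemma logn_bin_le p n m : prime p -> 0 < n -> m <= n ->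
  p ^ logn p 'C(n, m) <= n.
Proof.
move=> pp n0 mn; have p1 := prime_gt1 pp.
suff le : logn p 'C(n, m) <= trunc_log p n.
  by apply: leq_trans (trunc_logP p1 n0); rewrite leq_exp2l.
have := congr1 (logn p) (bin_fact mn).
rewrite !lognM ?muln_gt0 ?fact_gt0 ?bin_gt0 //.
rewrite (logn_fact_wide pp mn) (logn_fact_wide pp (leq_subr m n)).
rewrite (logn_fact_wide pp (leqnn n)) -big_split /= => e.
have {e} : logn p 'C(n, m) <= \sum_(1 <= k < n.+1) (k <= trunc_log p n : nat).
  (* termwise, n %/ q exceeds m %/ q + (n - m) %/ q by at most one, and not at all if n < q *)
  rewrite -(leq_add2r (\sum_(1 <= i < n.+1) (m %/ p ^ i + (n - m) %/ p ^ i))).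
  rewrite e -big_split /=; apply: leq_sum => k _.
  have q0 : 0 < p ^ k by rewrite expn_gt0 prime_gt0.
  case: (leqP (p ^ k) n) => h; last by rewrite divn_small.
  rewrite (trunc_log_max p1 h) -[in X in X <= _](subnKC mn) divnD //.
  by rewrite [leqLHS]addnC leq_add2r leq_b1.
move/leq_trans; apply.
have tn : trunc_log p n <= n by apply/(leq_trans (ltnW (ltn_expl _ p1)))/trunc_logP.
rewrite (@big_cat_nat _ _ _ (trunc_log p n).+1) //=.
rewrite [X in _ + X]big_nat_cond [X in _ + X]big1 ?addn0; last first.
  by move=> k /andP[/andP[h _] _]; rewrite leqNgt h.
apply: (@leq_trans (\sum_(1 <= k < (trunc_log p n).+1) 1)).
  by apply: leq_sum => k _; apply: leq_b1.
by rewrite sum_nat_const_nat; lia.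
Qed.

(** The increasing list of the primes [p <= n]. *)
Definition primes_upto n := [seq p <- iota 0 n.+1 | prime p].

Lemma bin_le_exp_primes n m : 0 < n -> m <= n ->
  'C(n, m) <= n ^ size (primes_upto n).
Proof.
move=> n0 mn; have c0 : 0 < 'C(n, m) by rewrite bin_gt0.
rewrite [leqLHS](prod_prime_decomp c0) prime_decompE big_map /=.
have prP p : p \in primes 'C(n, m) -> prime p /\ p <= n.
  rewrite mem_primes => /and3P[pp _ dv]; split=> //.
  apply: leq_trans (logn_bin_le pp n0 mn).
  by rewrite -[leqLHS]expn1 leq_exp2l ?prime_gt1 // -pfactor_dvdn.
apply: (@leq_trans (\prod_(p <- primes 'C(n, m)) n)).
  rewrite big_seq [leqRHS]big_seq; apply: leq_prod => p /prP[pp _].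
  exact: logn_bin_le.
rewrite big_const_seq count_predT iter_muln_1.
rewrite leq_pexp2l // uniq_leq_size ?primes_uniq // => p /prP[pp pn].
by rewrite mem_filter pp mem_iota /= add0n ltnS.
Qed.

(** A weak form of Chebyshev's lower bound on the number of primes. *)
Lemma exp2_le_exp_primes n : 0 < n -> 2 ^ n <= n.+1 * n ^ size (primes_upto n).
Proof.
move=> n0; rewrite -[2]/(1 + 1) expnDn.
rewrite -[X in X * _]card_ord -sum_nat_const; apply: leq_sum => i _.
by rewrite !exp1n !muln1 bin_le_exp_primes // -ltnS.
Qed.

(** With [X = 2 ^ s] and [s = 2 ^ t], the number [r] is [X / (4 s)]; the lower bound
    [r < p] is what makes the product of the primes larger than [r ^ r]. *)
Lemma many_primes t : 2 < t ->
  let s := 2 ^ t in let r := 2 ^ (s - t - 2) in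
  exists ps : seq nat, [/\ size ps = r, uniq ps &
    forall p, p \in ps -> [/\ prime p, r < p & p <= 2 ^ s]].
Proof.
move=> t2 s r; set X := 2 ^ s.
have ts : t.+2 <= s.
  rewrite /s; elim: t t2 {s r X} => // t IH; rewrite expnS ltnS leq_eqVlt.
  by case/orP=> [/eqP<- //|/IH]; lia.
have r0 : 0 < r by rewrite expn_gt0.
have s1 : 1 < s by lia.
have XE : X = s * (4 * r).
  by rewrite /X /r /s -[4]/(2 ^ 2) -!expnD; congr (2 ^ _); rewrite -/s; lia.
have X0 : 0 < X by rewrite expn_gt0.
have := exp2_le_exp_primes X0; set q := size _ => le.
have {}le : X <= s.+1 + s * q.
  rewrite -(leq_exp2l (m := 2)) // expnD expnM -/X; apply: leq_trans le _.
  by rewrite leq_mul2r expnS -/X; apply/orP; right; lia.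
(* at least 4 r - 1 primes up to X, of which at most r are not larger than r *)
have qr : 4 * r <= q.+1.
  rewrite leqNgt; apply/negP => lt.
  suff : s * q.+2 <= X by rewrite !mulnS; lia.
  by rewrite XE leq_mul2l lt orbT.
pose L := [seq p <- primes_upto X | r < p].
have uL : uniq L by rewrite !filter_uniq ?iota_uniq.
have szL : r <= size L.
  have e : q = size L + size [seq p <- primes_upto X | ~~ (r < p)].
    by rewrite !size_filter count_predC.
  have : size [seq p <- primes_upto X | ~~ (r < p)] <= r.
    rewrite -[leqRHS](size_iota 1) uniq_leq_size ?filter_uniq ?iota_uniq // => p.
    rewrite !mem_filter -leqNgt => /and3P[pr /prime_gt0 p0 _].
    by rewrite mem_iota p0 add1n ltnS.
  lia.
exists (take r L); split; rewrite ?size_takel ?take_uniq // => p /mem_take.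
by rewrite !mem_filter mem_iota => /and3P[-> -> /andP[_]].
Qed.

(** * The graph with cyclic core *)

(** Names of the vertices: [Outer i] is the [i]-th outer vertex; [Hub j y], [Tip j y] and
    [Link j y] form the triangle at position [y] of the [j]-th cycle. *)
Inductive code := Outer of nat | Hub of nat & nat | Tip of nat & nat | Link of nat & nat.

Definition is_outer c := if c is Outer _ then true else false.
Definition is_hub c := if c is Hub _ _ then true else false.
Definition is_link c := if c is Link _ _ then true else false.

Section CyclicGraph.
Variables (r : nat) (p : nat -> nat).

(** The names in use when there are [r] cycles, of lengths [p j], and [k] outer vertices. *)
Definition valid k c :=
  match c with
  | Outer i => i < k
  | Hub j y | Tip j y | Link j y => (j < r) && (y < p j)
  end.

(** Adjacency of names is the symmetric closure of [arc]. *)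
Definition arc c d :=
  match c, d with
  | Outer i, Hub j y => y == i %% p j
  | Hub j y, Tip j' y' | Hub j y, Link j' y' | Tip j y, Link j' y' => (j == j') && (y == y')
  | Link j y, Hub j' y' => (j == j') && (y' == y.+1 %% p j)
  | _, _ => false
  end.

Definition code_adj c d := arc c d || arc d c.

Lemma code_adjC c d : code_adj c d = code_adj d c.
Proof. by rewrite /code_adj orbC. Qed.

Lemma code_adjxx c : code_adj c c = false.
Proof. by case: c. Qed.

(** The labelling [c] identifies [G] with the graph on the names valid for [k]. Working up
    to labelling lets the subgraphs left by successive deletions be treated uniformly. *)
Definition coded k (G : sgraph) (c : G -> code) :=
  [/\ injective c, forall v, valid k (c v),
      forall x, valid k x -> exists v, c v = x &
      forall u v, adj u v = code_adj (c u) (c v)].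

Hypothesis r_gt0 : 0 < r.
Hypothesis p_gt1 : forall j, j < r -> 1 < p j.

Lemma mod_valid j y : j < r -> (j < r) && (y %% p j < p j).
Proof. by move=> jr; rewrite jr ltn_mod ltnW ?p_gt1. Qed.

Section Coded.
Variables (k : nat) (G : sgraph) (c : G -> code).
Hypothesis codedG : coded k c.
(* every hub is adjacent to an outer vertex *)
Hypothesis p_le : forall j, j < r -> p j <= k.

Let c_inj : injective c. Proof. by case: codedG. Qed.
Let c_valid v : valid k (c v). Proof. by case: codedG. Qed.
Let c_surj x : valid k x -> exists v, c v = x.
Proof. by case: codedG => _ _ h _; apply: h. Qed.
Let c_adj u v : adj u v = code_adj (c u) (c v). Proof. by case: codedG. Qed.

Let k_gt0 : 0 < k.
Proof. by apply: leq_trans (p_le r_gt0); rewrite ltnW ?p_gt1. Qed.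

Lemma coded_connected : connected_graph G.
Proof.
have [w0 cw0] := @c_surj (Outer 0) k_gt0.
split; first by apply/card_gt0P; exists w0.
have sym : connect_sym (@adj G) by apply/sym_connect_sym/adj_sym.
suff to0 v : connect adj w0 v by move=> x y; rewrite (connect_trans _ (to0 y)) // sym.
have step u u' : connect adj w0 u -> code_adj (c u) (c u') -> connect adj w0 u'.
  by move=> h h'; apply: connect_trans h (connect1 _); rewrite c_adj.
have hH y : forall j u, c u = Hub j y -> connect adj w0 u.
  elim: y => [|y IH] j u cu; have := c_valid u; rewrite cu /= => /andP[jr yp].
    by apply: (step w0) => //; rewrite cw0 cu /code_adj /= mod0n eqxx.
  have yp' : (j < r) && (y < p j) by rewrite jr ltnW.
  have [a ca] := @c_surj (Hub j y) yp'; have [b cb] := @c_surj (Link j y) yp'.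
  apply: (step b); last by rewrite cb cu /code_adj /= modn_small ?eqxx.
  by apply: (step a); [apply: (IH j) | rewrite ca cb /code_adj /= !eqxx].
case cv : (c v) => [i|j y|j y|j y].
- have [a ca] := @c_surj (Hub 0 (i %% p 0)) (mod_valid i r_gt0).
  by apply: (step a); [apply: hH ca | rewrite ca cv /code_adj /= eqxx].
- exact: hH cv.
- have := c_valid v; rewrite cv => /= yp; have [a ca] := @c_surj (Hub j y) yp.
  by apply: (step a); [apply: hH ca | rewrite ca cv /code_adj /= !eqxx].
- have := c_valid v; rewrite cv => /= yp; have [a ca] := @c_surj (Hub j y) yp.
  by apply: (step a); [apply: hH ca | rewrite ca cv /code_adj /= !eqxx].
Qed.

(** The next three lemmas characterise outer vertices, hubs and links in terms of the
    graph alone, so that automorphisms preserve them. *)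
Lemma not_outer_triangle v :
  (exists u w, [/\ adj v u, adj v w & adj u w]) <-> ~~ is_outer (c v).
Proof.
split=> [[u [w]]|].
  rewrite !c_adj /code_adj; case: (c v) => //= i.
  by case: (c u) => [?|? ?|? ?|? ?]; case: (c w) => [?|? ?|? ?|? ?] // [].
have e j y : valid k (Hub j y) ->
    exists a b d, [/\ c a = Hub j y, c b = Tip j y & c d = Link j y].
  move=> h; have [a ca] := @c_surj (Hub j y) h; have [b cb] := @c_surj (Tip j y) h.
  by have [d cd] := @c_surj (Link j y) h; exists a, b, d.
have := c_valid v; case cv : (c v) => [//|j y|j y|j y] /e[a [b [d [ca cb cd]]]] _.
- by exists b, d; rewrite !c_adj cv cb cd /code_adj /= !eqxx.
- by exists a, d; rewrite !c_adj cv ca cd /code_adj /= !eqxx ?orbT.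
- by exists a, b; rewrite !c_adj cv ca cb /code_adj /= !eqxx !orbT.
Qed.

Lemma hub_adj_outer v :
  (~~ is_outer (c v) /\ exists2 u, is_outer (c u) & adj v u) <-> is_hub (c v).
Proof.
split=> [[h [u]]|].
  by rewrite c_adj; case: (c u) => // i _; move: h; case: (c v).
have := c_valid v; case cv : (c v) => [//|j y|//|//] /= /andP[jr yp] _.
have [w cw] := @c_surj (Outer y) (leq_trans yp (p_le jr)).
by split=> //; exists w; rewrite ?c_adj cw ?cv //= /code_adj /= modn_small ?eqxx.
Qed.

Lemma link_adj_hubs v :
  (~~ is_outer (c v) /\ ~~ is_hub (c v) /\
   exists u w, [/\ is_hub (c u), is_hub (c w), u <> w, adj v u & adj v w])
  <-> is_link (c v).
Proof.
split=> [[hO [hH [u [w]]]]|].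
  rewrite !c_adj => -[hu hw nuw]; move: hO hH hu hw (@c_inj u w).
  case: (c v) => // j y _ _; case: (c u) => // j1 y1 _; case: (c w) => // j2 y2 _ inj.
  rewrite /code_adj /= ?orbF => /andP[/eqP ? /eqP ?] /andP[/eqP ? /eqP ?].
  by subst; case: nuw; apply: inj.
have := c_valid v; case cv : (c v) => [//|//|//|j y] /= yp _; do 2!split=> //.
have [a ca] := @c_surj (Hub j y) yp; have /andP[jr yj] := yp.
have [b cb] := @c_surj (Hub j (y.+1 %% p j)) (mod_valid _ jr).
exists a, b; rewrite !c_adj ca cb cv /code_adj /= !eqxx !orbT; split=> //.
move=> ab; move: ca; rewrite ab cb => -[].
have p1 := p_gt1 jr; move: yj; rewrite leq_eqVlt => /orP[/eqP e|lt].
  by rewrite e modnn; lia.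
by rewrite modn_small //; lia.
Qed.

Section Automorphism.
Hypothesis p_dvd_inj : forall j j', j < r -> j' < r -> p j' %| p j -> j' = j.
Variable N : nat.
(* in the application, N is the product of the p j *)
Hypothesis crt : forall a b, (forall j, j < r -> a = b %[mod p j]) -> a = b %[mod N].
Hypothesis kN : k < N.
Variable f : G -> G.
Hypothesis fP : isomorphism f.

Let f_bij : bijective f. Proof. by case: fP. Qed.
Let f_adj u v : adj (f u) (f v) = adj u v. Proof. by case: fP. Qed.
Let f_inj : injective f. Proof. exact: bij_inj. Qed.
Let f_surj v : exists u, v = f u.
Proof. by case: f_bij => g _ gK; exists (g v). Qed.

Let f_is_outer v : is_outer (c (f v)) = is_outer (c v).
Proof.
apply: negb_inj; apply/idP/idP => /not_outer_triangle[u [w [e1 e2 e3]]];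
  apply/not_outer_triangle.
  move: e1 e2 e3; have [u' ->] := f_surj u; have [w' ->] := f_surj w.
  by rewrite !f_adj => *; exists u', w'.
by exists (f u), (f w); rewrite !f_adj.
Qed.

Let f_is_hub v : is_hub (c (f v)) = is_hub (c v).
Proof.
apply/idP/idP => /hub_adj_outer[hO [u hu e]]; apply/hub_adj_outer.
  move: hu e; have [u' ->] := f_surj u; rewrite f_is_outer f_adj => hu e.
  by split; [rewrite -f_is_outer | exists u'].
by split; [rewrite f_is_outer | exists (f u); rewrite ?f_is_outer ?f_adj].
Qed.

Let f_is_link v : is_link (c (f v)) = is_link (c v).
Proof.
apply/idP/idP => /link_adj_hubs[hO [hH [u [w]]]] h; apply/link_adj_hubs.
  move: hO hH h; have [u' ->] := f_surj u; have [w' ->] := f_surj w.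
  rewrite f_is_outer !f_is_hub !f_adj => ? ? [? ? nuw ? ?].
  split=> //; split=> //; exists u', w'; split=> // e; apply: nuw; congruence.
case: h => ? ? nuw *; split; rewrite ?f_is_outer //; split; rewrite ?f_is_hub //.
by exists (f u), (f w); rewrite !f_is_hub !f_adj; split=> // /f_inj.
Qed.

Let f_outer v i : c v = Outer i -> exists2 i', c (f v) = Outer i' & i' < k.
Proof.
move=> cv; have := f_is_outer v; have := c_valid (f v); rewrite cv.
by case: (c (f v)) => // i' lt _; exists i'.
Qed.

Let f_hub v j y : c v = Hub j y ->
  exists j' y', c (f v) = Hub j' y' /\ (j' < r) && (y' < p j').
Proof.
move=> cv; have := f_is_hub v; have := c_valid (f v); rewrite cv.
by case: (c (f v)) => // j' y' lt _; exists j', y'.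
Qed.

Let f_link v j y : c v = Link j y -> exists j' y', c (f v) = Link j' y'.
Proof.
move=> cv; have := f_is_link v; rewrite cv.
by case: (c (f v)) => // j' y' _; exists j', y'.
Qed.

Let f_tip v j y : c v = Tip j y -> exists j' y', c (f v) = Tip j' y'.
Proof.
move=> cv; have := f_is_link v; have := f_is_hub v; have := f_is_outer v; rewrite cv.
by case: (c (f v)) => // j' y' _; exists j', y'.
Qed.

(** Automorphisms commute with the successor map on hubs. *)
Lemma automorphism_succ u v j y j' y' :
  c u = Hub j y -> c v = Hub j (y.+1 %% p j) -> c (f u) = Hub j' y' ->
  c (f v) = Hub j' (y'.+1 %% p j').
Proof.
move=> cu cv cfu; have := c_valid u; rewrite cu /= => yp; have /andP[jr _] := yp.
have [b cb] := c_surj (yp : valid k (Tip j y)).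
have [d cd] := c_surj (yp : valid k (Link j y)).
have [jb [yb cfb]] := f_tip cb; have [jd [yd cfd]] := f_link cd.
have [jv [yv [cfv _]]] := f_hub cv.
have nuv : u <> v.
  move=> e; move: cu; rewrite e cv => -[]; have := p_gt1 jr.
  have /andP[_] := yp; rewrite leq_eqVlt => /orP[/eqP <-|lt]; first by rewrite modnn; lia.
  by rewrite modn_small //; lia.
have := f_adj u b; have := f_adj b d; have := f_adj d v.
rewrite !c_adj cfu cfb cfd cfv cu cv cb cd /code_adj /= !eqxx /= !orbF.
move=> e3 /andP[/eqP e2 /eqP e2'] /andP[/eqP e1 /eqP e1']; subst jb yb jd yd.
case/orP: e3 => /andP[/eqP e /eqP e']; subst jv yv => //.
by case: nuv; apply/f_inj/c_inj; rewrite cfu cfv.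
Qed.

(** The orbit of a hub under the successor map has length [p j], and [f] maps it to an
    orbit of length [p j']; hence [p j'] divides [p j]. *)
Lemma automorphism_component v j y : c v = Hub j y -> exists y', c (f v) = Hub j y'.
Proof.
move=> cv; have := c_valid v; rewrite cv /= => /andP[jr yp].
have [j' [y' [cfv /andP[j'r yp']]]] := f_hub cv.
have iter m u : c u = Hub j ((y + m) %% p j) -> c (f u) = Hub j' ((y' + m) %% p j').
  elim: m u => [|m IH] u cu.
    rewrite addn0 modn_small // -cfv; congr (c (f _)); apply: c_inj.
    by rewrite cu cv addn0 modn_small.
  have [w cw] := c_surj (mod_valid (y + m) jr : valid k (Hub j _)).
  rewrite addnS -addn1 -modnDml addn1; apply: (automorphism_succ cw) (IH _ cw).
  by rewrite cu addnS -[in RHS]addn1 modnDml addn1.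
have := iter (p j) v; rewrite modnDr modn_small // => /(_ cv).
rewrite cfv => -[e]; exists y'; rewrite (p_dvd_inj jr j'r) //.
move/esym/eqP: e; rewrite -[X in _ == X](modn_small yp') -[X in _ == X %[mod _]]addn0.
by rewrite eqn_modDl mod0n.
Qed.

Lemma automorphism_outer v i : c v = Outer i -> f v = v.
Proof.
have [w0 cw0] := c_surj (k_gt0 : valid k (Outer 0)).
have [t cfw0 tk] := f_outer cw0.
(* f sends the hub of cycle j adjacent to u to the hub of cycle j adjacent to f u *)
have coord u i' j a : j < r -> c u = Outer i' -> c a = Hub j (i' %% p j) ->
    exists m, c (f u) = Outer m /\ c (f a) = Hub j (m %% p j).
  move=> jr cu ca; have [m cfu _] := f_outer cu; have [y' cfa] := automorphism_component ca.
  exists m; split=> //; have := f_adj u a; rewrite !c_adj cfu cfa cu ca /code_adj /= eqxx.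
  by rewrite orbF => /eqP ->.
(* f translates the numbers of the outer vertices: the congruence modulo N is an
   equality because both sides are at most k < N *)
have shift i' u : c u = Outer i' -> c (f u) = Outer (t + i').
  elim: i' u => [|i' IH] u cu.
    by rewrite addn0 -cfw0; congr (c (f _)); apply: c_inj; rewrite cu.
  have := c_valid u; rewrite cu => /= ik.
  have [u' cu'] := c_surj (ltnW ik : valid k (Outer i')).
  have [m cfu mk] := f_outer cu; rewrite cfu.
  have e : m = (t + i').+1 %[mod N].
    apply: crt => j jr.
    have [a ca] := c_surj (mod_valid i' jr : valid k (Hub j _)).
    have [b cb] := c_surj (mod_valid i'.+1 jr : valid k (Hub j _)).
    have [m1 [cfu1 cfa]] := coord _ _ _ _ jr cu' ca.
    have [m2 [cfu2 cfb]] := coord _ _ _ _ jr cu cb.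
    move: cfu1; rewrite (IH _ cu') => -[?]; subst m1.
    move: cfu2; rewrite cfu => -[?]; subst m2.
    have := automorphism_succ ca _ cfa; move/(_ b).
    rewrite cb -[X in _ = Hub j (X %% _)]addn1 modnDml addn1 => /(_ erefl).
    rewrite cfb => -[->].
    by rewrite -[in LHS]addn1 modnDml addn1.
  have := c_valid (f u'); rewrite (IH _ cu') => /= lt.
  by move: e; rewrite !modn_small //; [move=> ->; rewrite addnS | lia | lia].
(* the last outer vertex has nowhere to go unless the translation is trivial *)
have t0 : t = 0.
  have lt : k.-1 < k by rewrite prednK.
  have [u cu] := c_surj (lt : valid k (Outer _)).
  by have := c_valid (f u); rewrite (shift _ _ cu) /=; lia.
by move=> cv; apply: c_inj; rewrite (shift _ _ cv) t0 cv.
Qed.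

Lemma automorphism_hub v j y : c v = Hub j y -> f v = v.
Proof.
move=> cv; have := c_valid v; rewrite cv /= => /andP[jr yp].
have [y' cfv] := automorphism_component cv.
have [w cw] := c_surj (leq_trans yp (p_le jr) : valid k (Outer _)).
have := f_adj w v; rewrite (automorphism_outer cw) !c_adj cw cv cfv /code_adj /= !orbF.
by rewrite (modn_small yp) eqxx => /eqP e; apply: c_inj; rewrite cfv cv e.
Qed.

Lemma automorphism_id v : f v = v.
Proof.
case cv : (c v) => [i|j y|j y|j y]; first exact: automorphism_outer cv.
- exact: automorphism_hub cv.
- have := c_valid v; rewrite cv /= => yp.
  have [a ca] := c_surj (yp : valid k (Hub j y)); have [j' [y' cfv]] := f_tip cv.
  have := f_adj a v; rewrite (automorphism_hub ca) !c_adj ca cv cfv /code_adj /= !eqxx !orbF.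
  by case/andP=> /eqP e /eqP e'; apply: c_inj; rewrite cfv cv e e'.
have := c_valid v; rewrite cv /= => yp.
have [b cb] := c_surj (yp : valid k (Tip j y)).
have [a ca] := c_surj (yp : valid k (Hub j y)).
have fb : f b = b.
  have [j' [y' cfb]] := f_tip cb.
  have := f_adj a b; rewrite (automorphism_hub ca) !c_adj ca cb cfb /code_adj /= !eqxx !orbF.
  by case/andP=> /eqP e /eqP e'; apply: c_inj; rewrite cfb cb e e'.
have [j' [y' cfv]] := f_link cv.
have := f_adj b v; rewrite fb !c_adj cb cv cfv /code_adj /= !eqxx !orbF.
by case/andP=> /eqP e /eqP e'; apply: c_inj; rewrite cfv cv e e'.
Qed.

End Automorphism.

Lemma coded_asymmetric N :
  (forall j j', j < r -> j' < r -> p j' %| p j -> j' = j) ->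
  (forall a b, (forall j, j < r -> a = b %[mod p j]) -> a = b %[mod N]) ->
  k < N -> asymmetric_graph G.
Proof. by move=> p_dvd crt kN f fP v; apply: (automorphism_id p_dvd crt kN fP). Qed.

End Coded.

(** Deleting the outer vertices numbered from [k] on. *)
Lemma coded_del k K (G : sgraph) (c : G -> code) (S : {set G}) : k <= K -> coded K c ->
  (forall x, reflect (exists2 i, c x = Outer i & k <= i) (x \in S)) ->
  @coded k (del_vertices S) (c \o val).
Proof.
move=> kK [c_inj c_valid c_surj c_adj] SP; split=> [u v /c_inj/val_inj//|u|x vx|u v] /=.
- have := c_valid (val u); case cu : (c (val u)) => [i|//|//|//] /= _.
  by rewrite ltnNge; apply/negP => ki; move/negP: (valP u); apply; apply/SP; exists i.
- have vx' : valid K x by case: x vx => //= i /leq_trans; apply.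
  have [v cv] := c_surj x vx'.
  have vS : v \notin S.
    by apply/SP => -[i]; rewrite cv => e; rewrite e /= in vx; rewrite leqNgt vx.
  by exists (Sub v vS); rewrite /= cv.
- by rewrite -c_adj.
Qed.

(** The rotation of the core, extended to the outer vertices by [i |-> i + 1]. *)
Definition shift c :=
  match c with
  | Outer i => Outer i.+1
  | Hub j y => Hub j (y.+1 %% p j)
  | Tip j y => Tip j (y.+1 %% p j)
  | Link j y => Link j (y.+1 %% p j)
  end.

Lemma eq_succ_mod j x y : x < p j -> y < p j -> (x.+1 %% p j == y.+1 %% p j) = (x == y).
Proof. by move=> xp yp; rewrite -[x.+1]addn1 -[y.+1]addn1 eqn_modDr !modn_small. Qed.

Lemma shift_inj k x y : valid k x -> valid k y -> shift x = shift y -> x = y.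
Proof.
case: x y => [i|j m|j m|j m] [i'|j' m'|j' m'|j' m'] //=; first by move=> _ _ [->].
all: move=> /andP[_ h] /andP[_ h'] [e /eqP]; subst j'.
all: by rewrite eq_succ_mod // => /eqP ->.
Qed.

Lemma shift_adj k x y : valid k x -> valid k y ->
  code_adj (shift x) (shift y) = code_adj x y.
Proof.
suff arc_shift u v : valid k u -> valid k v -> arc (shift u) (shift v) = arc u v.
  by move=> vx vy; rewrite /code_adj !arc_shift.
case: u v => [i|j m|j m|j m] [i'|j' m'|j' m'|j' m'] //=.
- move=> _ /andP[jr h]; rewrite -[in RHS](modn_small h).
  by rewrite -[i.+1]addn1 -[m'.+1]addn1 eqn_modDr.
- by move=> /andP[_ h] /andP[_ h']; case: eqP => //= e; subst; rewrite eq_succ_mod.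
- by move=> /andP[_ h] /andP[_ h']; case: eqP => //= e; subst; rewrite eq_succ_mod.
- by move=> /andP[_ h] /andP[_ h']; case: eqP => //= e; subst; rewrite eq_succ_mod.
- move=> /andP[jr h] /andP[_ h']; case: eqP => //= e; subst.
  by rewrite eq_succ_mod ?ltn_mod //; lia.
Qed.

Lemma isomorphic_sym (G H : sgraph) : isomorphic G H -> isomorphic H G.
Proof.
move=> [f [[g gK fK] f_adj]]; exists g; split; first by exists f.
by move=> x y; rewrite -f_adj !fK.
Qed.

Lemma card_del1 (G : sgraph) (v : G) : #|del_vertices [set v]| = #|G|.-1.
Proof. by rewrite card_sig (eq_card (B := [set~ v])) ?cardsC1 // => x; rewrite !inE. Qed.

(** The rotation maps the graph without its last outer vertex to the graph without its
    first one. *)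
Lemma coded_removal_similar k (G : sgraph) (c : G -> code) u v :
  coded k.+1 c -> c u = Outer 0 -> c v = Outer k -> removal_similar u v.
Proof.
move=> [c_inj c_valid c_surj c_adj] cu cv; apply: isomorphic_sym.
have ex (x : del_vertices [set v]) : exists y : del_vertices [set u],
    c (val y) = shift (c (val x)).
  have xv : c (val x) <> Outer k.
    by rewrite -cv => /c_inj e; have := valP x; rewrite e inE eqxx.
  have : valid k.+1 (shift (c (val x))).
    have := c_valid (val x); case: (c (val x)) xv => [i|j y|j y|j y] //= h.
    - by rewrite !ltnS leq_eqVlt => /orP[/eqP e|//]; case: h; rewrite e.
    - by case/andP=> jr _; apply: mod_valid.
    - by case/andP=> jr _; apply: mod_valid.
    - by case/andP=> jr _; apply: mod_valid.
  move/c_surj => [y cy].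
  have yu : y \notin [set u].
    by rewrite inE; apply/eqP => e; move: cy; rewrite e cu; case: (c _).
  by exists (Sub y yu).
have [f fE] := choice ex; exists f; split.
  apply: inj_card_bij; last by rewrite !card_del1.
  move=> x y e; apply/val_inj/c_inj/(@shift_inj k.+1) => //.
  by rewrite -!fE e.
by move=> x y; rewrite /= /del_adj !c_adj !fE (@shift_adj k.+1).
Qed.

(** * The chain *)

(** The chain removes the outer vertices numbered [K - 1, ..., k0], in this order; the mate
    of the vertex being removed is always the outer vertex [0]. *)
Lemma coded_chain N K k0 (G : sgraph) (c : G -> code) :
  (forall j j', j < r -> j' < r -> p j' %| p j -> j' = j) ->
  (forall a b, (forall j, j < r -> a = b %[mod p j]) -> a = b %[mod N]) ->
  (forall j, j < r -> p j <= k0) -> k0 <= K < N -> coded K c ->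
  exists s : seq G, [/\ active_chain s, size s = K - k0 &
    forall j, j <= size s ->
      connected_graph (chain_graph s j) /\ asymmetric_graph (chain_graph s j)].
Proof.
move=> p_dvd crt p_le /andP[k0K KN] cG; have [c_inj c_valid c_surj c_adj] := cG.
have k01 : 1 < k0 := leq_trans (p_gt1 r_gt0) (p_le _ r_gt0).
have [v0 _] := c_surj (Outer 0) (leq_trans (ltnW k01) k0K).
have /choice[w wE] i : exists v, i < K -> c v = Outer i.
  by case: (ltnP i K) => [/(c_surj (Outer i))[v cv]|_]; [exists v | exists v0].
pose s := mkseq (fun j => w (K - j.+1)) (K - k0).
have size_s : size s = K - k0 by rewrite size_mkseq.
have codedK j : j <= size s -> @coded (K - j) (chain_graph s j) (c \o val).
  rewrite size_s => js; apply: coded_del (leq_subr _ _) cG _ => x; rewrite inE.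
  rewrite -map_take take_iota (minn_idPl js); apply: (iffP mapP) => [[i]|[i cx Ki]].
    rewrite mem_iota add0n => /andP[_ ij] ->; exists (K - i.+1); last lia.
    by apply: wE; lia.
  have := c_valid x; rewrite cx /= => iK; exists (K - i.+1); first by rewrite mem_iota; lia.
  by apply: c_inj; rewrite cx wE; [congr Outer; lia | lia].
have coded_ok j : j <= size s ->
    connected_graph (chain_graph s j) /\ asymmetric_graph (chain_graph s j).
  move=> js; have cj := codedK j js; rewrite size_s in js.
  have ple i : i < r -> p i <= K - j by move=> /p_le; lia.
  split; first exact: (coded_connected cj ple).
  by apply: (coded_asymmetric cj ple p_dvd crt); lia.
exists s; split=> //; split=> [|j js].
  apply/mkseq_uniqP => i j; rewrite !inE => iK jK.
  by move=> /(congr1 c); rewrite !wE; [case; lia | lia..].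
have cj := codedK j (ltnW js); have [_ asym] := coded_ok j (ltnW js).
have {}cj : @coded (K - j.+1).+1 (chain_graph s j) (c \o val).
  by rewrite -subSn ?subSS //; rewrite size_s in js; lia.
have [_ _ surj _] := cj.
have [x cx] := surj (Outer (K - j.+1)) (ltnSn _); have [y cy] := surj (Outer 0) (ltn0Sn _).
exists x; split.
  have jK : j < K by rewrite size_s in js; lia.
  have -> : val x = w (K - j.+1) by apply: c_inj; rewrite wE //; lia.
  by rewrite onthE (nth_map v0) // nth_mkseq // -size_s.
exists y; split; first exact: coded_removal_similar cj cy cx.
case=> f [/asym-> yx]; move: cx; rewrite -yx cy => -[]; rewrite size_s in js; lia.
Qed.

Section BaseGraph.
Variables (K X : nat).

(** A graph with [K] outer vertices; [X] only serves to bound the positions [y]. *)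
Definition base_vertex : finType :=
  ('I_K + {q : 'I_r * 'I_X * 'I_3 | q.1.2 < p q.1.1})%type.

(** The last component 0, 1, 2 of a core vertex stands for hub, tip, link. *)
Definition base_code (v : base_vertex) : code :=
  match v with
  | inl i => Outer i
  | inr q =>
    let j := (val q).1.1 in let y := (val q).1.2 in
    match val (val q).2 with 0 => Hub j y | 1 => Tip j y | _ => Link j y end
  end.

Definition base_adj : rel base_vertex := fun u v => code_adj (base_code u) (base_code v).

Lemma base_adj_sym : symmetric base_adj.
Proof. by move=> u v; apply: code_adjC. Qed.

Lemma base_adj_irrefl : irreflexive base_adj.
Proof. by move=> u; apply: code_adjxx. Qed.

Definition base_graph : sgraph := SGraph base_adj_sym base_adj_irrefl.

Lemma card_base_graph : K <= #|base_graph| <= K + 3 * (r * X).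
Proof.
rewrite /= card_sum card_ord leq_addr leq_add2l card_sig.
by apply: leq_trans (max_card _) _; rewrite !card_prod !card_ord mulnC.
Qed.

Lemma base_coded : (forall j, j < r -> p j <= X) -> @coded K base_graph base_code.
Proof.
move=> pX; split=> //.
- move=> [i|[[[j y] l] h]] [i'|[[[j' y'] l'] h']] /=.
  + by move=> [/val_inj ->].
  + by case: l' h' => -[|[|[|]]].
  + by case: l h => -[|[|[|]]].
  + move=> e; suff E : (j, y, l) = (j', y', l') by congr inr; apply: val_inj.
    move: e {h h'}.
    case: l l' => [[|[|[|//]]] hl] [[|[|[|//]]] hl'] //= [/val_inj-> /val_inj->];
    by congr (_, _, _); apply: val_inj.
- move=> [i|[[[j y] l] h]] /=; first exact: ltn_ord.
  by case: l {h} (h : y < p j) => -[|[|[|]]] //= _ ->; rewrite ltn_ord.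
have ex j y (l : 'I_3) : (j < r) && (y < p j) ->
  exists q : {q : 'I_r * 'I_X * 'I_3 | q.1.2 < p q.1.1},
    [/\ (val q).1.1 = j :> nat, (val q).1.2 = y :> nat & (val q).2 = l].
  case/andP=> jr yp; have yX := leq_trans yp (pX _ jr).
  by exists (exist _ (Ordinal jr, Ordinal yX, l) yp).
move=> [i|j y|j y|j y] /= h; first by exists (inl (Ordinal h)).
- have [q [qj qy ql]] := ex j y (@Ordinal 3 0 isT) h.
  by exists (inr q); rewrite /= qj qy ql.
- have [q [qj qy ql]] := ex j y (@Ordinal 3 1 isT) h.
  by exists (inr q); rewrite /= qj qy ql.
- have [q [qj qy ql]] := ex j y (@Ordinal 3 2 isT) h.
  by exists (inr q); rewrite /= qj qy ql.
Qed.

End BaseGraph.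
End CyclicGraph.

(** * Orders of magnitude *)

Lemma eqn_mod_prod_primes (ps : seq nat) a b : uniq ps -> all prime ps ->
  (forall q, q \in ps -> a = b %[mod q]) -> a = b %[mod \prod_(q <- ps) q].
Proof.
elim: ps => [|q ps IH] /=; first by rewrite big_nil !modn1.
move=> /andP[qps ups] /andP[pq pps] e; rewrite big_cons; apply/eqP.
rewrite chinese_remainder.
  rewrite e ?mem_head // eqxx /=; apply/eqP/IH => // x xps.
  by apply: e; rewrite inE xps orbT.
rewrite prime_coprime // Euclid_dvd_prod // big_has; apply/hasPn => x xps /=.
rewrite (dvdn_prime2 pq (allP pps _ xps)).
by apply: contraNneq qps => ->.
Qed.

(** The integer form of the result. The chain misses at most [X ^ 2 / s] vertices of [G],
    and the order of [G] lies between [2 ^ (X / 16)] and [2 ^ X]. *)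
Lemma long_chain_graph t : 2 < t ->
  let s := 2 ^ t in let X := 2 ^ s in
  exists G : sgraph,
    [/\ connected_graph G, asymmetric_graph G, t <= #|G|,
        exists2 a, X <= 16 * a & 2 ^ a <= #|G| <= 2 ^ X &
        exists vs : seq G, [/\ active_chain vs, s * #|G| <= s * size vs + X * X &
          forall j, j <= size vs ->
            connected_graph (chain_graph vs j) /\ asymmetric_graph (chain_graph vs j)]].
Proof.
move=> t2 s X; have [ps [size_ps u_ps psP]] := many_primes t2.
rewrite -/s in size_ps psP; set r := 2 ^ (s - t - 2) in size_ps psP; rewrite -/X in psP.
have [ts t8] : 4 * t.+2 <= 3 * s /\ t + 5 <= s.
  rewrite /s; elim: t t2 {s X ps size_ps u_ps psP r} => // t IH.
  by rewrite expnS ltnS leq_eqVlt => /orP[/eqP<- //|/IH]; lia.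
have r8 : 8 <= r by rewrite -[8]/(2 ^ 3) leq_exp2l //; lia.
have XE : X = 4 * (s * r).
  by rewrite /X /r /s -[4]/(2 ^ 2) -!expnD; congr (2 ^ _); rewrite -/s; lia.
have tX : t < X by apply: leq_trans (ltn_expl t _) (ltnW (ltn_expl _ _)).
pose p := nth 0 ps; pose N := \prod_(q <- ps) q.
have p_in j : j < r -> p j \in ps by move=> jr; rewrite mem_nth ?size_ps.
have p_gt1 j : j < r -> 1 < p j by move=> /p_in/psP[/prime_gt1].
have p_leX j : j < r -> p j <= X by move=> /p_in/psP[].
have p_dvd j j' : j < r -> j' < r -> p j' %| p j -> j' = j.
  move=> jr j'r; have [pj _ _] := psP _ (p_in _ jr); have [pj' _ _] := psP _ (p_in _ j'r).
  by rewrite dvdn_prime2 // nth_uniq ?size_ps // => /eqP.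
have crt a b : (forall j, j < r -> a = b %[mod p j]) -> a = b %[mod N].
  move=> e; apply: eqn_mod_prod_primes => //; first by apply/allP => q /psP[].
  by move=> q /(nthP 0)[j]; rewrite size_ps => jr <-; apply: e.
have N_lb : r.+1 ^ r <= N.
  rewrite -{2}size_ps -iter_muln_1 -count_predT -big_const_seq /N.
  by rewrite big_seq [leqRHS]big_seq; apply: leq_prod => q /psP[].
have N_ub : N <= X ^ r.
  rewrite -size_ps -iter_muln_1 -count_predT -big_const_seq /N.
  by rewrite big_seq [leqRHS]big_seq; apply: leq_prod => q /psP[].
have rN : r ^ r < N by apply: leq_trans N_lb; rewrite ltn_exp2r //; lia.
have r_gt0 : 0 < r by lia.
have rrE : r ^ r = 2 ^ ((s - t - 2) * r) by rewrite expnM.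
have XN : X <= r ^ r.
  rewrite rrE /X leq_exp2l //; apply: (@leq_trans ((s - t - 2) * 8)); first lia.
  by rewrite leq_mul2l r8 orbT.
(* N - 1 outer vertices, the largest number for which the graph is asymmetric *)
pose K := N.-1.
have /andP[K_le le_K] := card_base_graph r p K X.
set G := base_graph r p K X in K_le le_K.
have cG : @coded r p K G (@base_code r p K X) by apply: base_coded.
have KN : X <= K < N by lia.
have pK j : j < r -> p j <= K by move=> /p_leX; lia.
exists G; split.
- exact: (coded_connected r_gt0 p_gt1 cG pK).
- by apply: (coded_asymmetric r_gt0 p_gt1 cG pK p_dvd crt); lia.
- lia.
- exists ((s - t - 2) * r); first by rewrite XE; nia.
  rewrite -rrE; apply/andP; split; first lia.
  have X1 : 2 ^ X = X ^ (4 * r) by rewrite /X -expnM -/X XE mulnCA.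
  rewrite X1; apply: (@leq_trans (X ^ r.+1)); last by rewrite leq_exp2l; lia.
  have X2 : X * X <= X ^ r by rewrite -[X * X]/(X ^ 2) leq_exp2l; lia.
  have : 3 * (r * X) <= X * X by rewrite XE; nia.
  by rewrite expnS; nia.
have [vs [vs_chain size_vs vsP]] := coded_chain r_gt0 p_gt1 p_dvd crt p_leX KN cG.
exists vs; split=> //; rewrite size_vs.
(* the missing vertices are the core, of order at most 3 r X, and X outer vertices *)
suff : s * (3 * (r * X) + X) <= X * X by nia.
by rewrite {2}XE; nia.
Qed.

Import Order.TTheory GRing.Theory Num.Theory.
Local Open Scope classical_set_scope.
Local Open Scope ring_scope.

Lemma ln2_ge_half (R : realType) : 1 / 2 <= ln 2 :> R.
Proof.
have := @le_ln1Dx R (- (1 / 2)); rewrite (_ : 1 + - (1 / 2) = 2^-1); last lra.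
by rewrite lnV ?posrE //; lra.
Qed.

Lemma ln2_le1 (R : realType) : ln 2 <= 1 :> R.
Proof. by have := @le_ln1Dx R 1; rewrite (_ : 1 + 1 = 2); lra. Qed.

(** Under the bounds of [long_chain_graph] on the order [n], its logarithm lies between
    [X / 32] and [X], where [X = 2 ^ s], hence [ln (ln n) <= s]; and [1024 = 32 ^ 2]. *)
Lemma log_bound (R : realType) (s a n : nat) : (8 <= s)%N ->
  (2 ^ s <= 16 * a)%N -> (2 ^ a <= n <= 2 ^ (2 ^ s))%N ->
  (2 ^ s)%:R ^+ 2 / s%:R <= 1024 * (ln (n%:R : R) ^+ 2 / ln (ln n%:R)).
Proof.
move=> s8; set X := (2 ^ s)%N => Xa /andP[n_lb n_ub].
have l1 := ln2_ge_half R; have l2 := ln2_le1 R.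
have X256 : (256 <= X)%N by rewrite -[256%N]/(2 ^ 8)%N leq_exp2l.
have n_gt0 : 0 < n%:R :> R by rewrite ltr0n (leq_trans _ n_lb) // expn_gt0.
have pow2_gt0 m : (0 : R) < (2 ^ m)%:R by rewrite ltr0n expn_gt0.
have lnpow2 m : ln ((2 ^ m)%:R : R) = ln 2 * m%:R by rewrite natrX lnXn ?mulr_natr.
have lb : X%:R / 32 <= ln (n%:R : R).
  apply: (@le_trans _ _ (ln (2 ^ a)%:R)); last by rewrite ler_ln ?posrE ?ler_nat.
  have : X%:R <= 16 * a%:R :> R by rewrite -natrM ler_nat.
  rewrite lnpow2; have : 0 <= a%:R :> R by []. nra.
have ub : ln (n%:R : R) <= X%:R.
  apply: (@le_trans _ _ (ln (2 ^ X)%:R)); first by rewrite ler_ln ?posrE ?ler_nat.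
  rewrite lnpow2; have : 0 <= X%:R :> R by []. nra.
have X256R : 256 <= X%:R :> R by rewrite ler_nat.
have ln_gt1 : 1 < ln (n%:R : R) by lra.
have lnln_gt0 : 0 < ln (ln (n%:R : R)) by rewrite ln_gt0.
have lnln_ub : ln (ln (n%:R : R)) <= s%:R.
  apply: (@le_trans _ _ (ln (2 ^ s)%:R)); first by rewrite ler_ln ?posrE //; lra.
  rewrite lnpow2; have : 0 <= s%:R :> R by []. nra.
have s_gt0 : 0 < s%:R :> R by rewrite ltr0n; lia.
apply: (@le_trans _ _ (X%:R ^+ 2 / ln (ln (n%:R : R)))).
  by rewrite ler_wpM2l ?sqr_ge0 // lef_pV2 ?posrE.
rewrite mulrA ler_wpM2r ?invr_ge0 ?(ltW lnln_gt0) //.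
have -> : 1024 * ln (n%:R : R) ^+ 2 = (32 * ln n%:R) ^+ 2 by ring.
by rewrite lerXn2r ?nnegrE //; lra.
Qed.

Theorem corollary6p2 (R : realType) :
  exists (C : R) (G : nat -> sgraph),
    #|G i| @[i --> \oo] --> \oo /\
    forall i : nat,
      let n : R := #|G i|%:R in
      let bound : R := n - C * (ln n ^+ 2 / ln (ln n)) in
      [/\ connected_graph (G i),
          asymmetric_graph (G i),
          (psd (G i))%:R >= bound &
          exists s : seq (G i),
            [/\ active_chain s,
                (size s)%:R >= bound &
                forall j : nat, (j <= size s)%N ->
                  connected_graph (chain_graph s j) /\
                  asymmetric_graph (chain_graph s j)]].
Proof.
have /choice[G GP] i := @long_chain_graph i.+3 isT.
exists 1024, G; split.
  apply/cvgnyPge => m; apply: filterS (nbhs_infty_ge m) => i mi.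
  by have [_ _ h _ _] := GP i; lia.
move=> i n bound; have [G_conn G_asym _ [a Xa nX] [vs [vs_chain size_vs vsP]]] := GP i.
have s8 : (8 <= 2 ^ i.+3)%N by rewrite -[8%N]/(2 ^ 3)%N leq_exp2l.
have size_bound : bound <= (size vs)%:R.
  have s_gt0 : 0 < (2 ^ i.+3)%:R :> R by rewrite ltr0n; lia.
  have le : n - (size vs)%:R <= (2 ^ 2 ^ i.+3)%:R ^+ 2 / (2 ^ i.+3)%:R.
    rewrite ler_pdivlMr //; move: size_vs.
    by rewrite -(ler_nat R) natrD !natrM -/n -expr2; lra.
  by have := log_bound R s8 Xa nX; rewrite -/n /bound; lra.
split=> //; last by exists vs.
apply: le_trans size_bound _; rewrite ler_nat /psd.
have vs_le : (size vs < #|G i|.+1)%N.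
  by rewrite ltnS -(card_uniqP vs_chain.1) max_card.
apply: (@leq_bigmax_cond _ _ (fun k : 'I__ => k : nat) (Ordinal vs_le)).
by apply/asboolP; exists vs.
Qed.
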